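(* Let $G$ be a discrete groupoid. Then there exists an étale groupoid $\beta_0G$ such that $G$ is a subgroupoid of $\beta_0G$ and $(\beta_0G)_0=\beta G_0$, the Stone–Čech compactification of the unit space $G_0$.
   Context: A topological groupoid $G$ has a space of arrows $G_1$, a space of objects (units) $G_0$, and continuous maps $d,r:G_1\to G_0$ (domain, range), $u:G_0\to G_1$ (units), $i:G_1\to G_1$ (inverse) and multiplication $xy$ defined when $r(x)=d(y)$, satisfying the usual groupoid axioms. It is étale if $d$ is a local homeomorphism. A discrete groupoid is a groupoid with the discrete topology (equivalently, an étale groupoid whose unit space is discrete). For a discrete space $X$, $\beta X$ is the space of ultrafilters on $X$ with topology generated by the sets $\tilde U=\{\mathcal F\mid U\in\mathcal F\}$, $U\subset X$; $X$ is embedded in $\beta X$ by sending $x$ to the principal ultrafilter at $x$, and the inclusion of $G_0$ into $(\beta_0G)_0=\beta G_0$ is this embedding. *)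

(* Defs.v *)
From HB Require Import structures.
From mathcomp Require Import all_boot all_order all_algebra.
From mathcomp Require Import all_classical topology.

Set Implicit Arguments.
Unset Strict Implicit.
Unset Printing Implicit Defensive.

Local Open Scope classical_set_scope.

Definition homeomorphism_on (X Y : topologicalType) (U : set X) (V : set Y)
    (f : X -> Y) (g : Y -> X) : Prop :=
  [/\ forall x, U x -> V (f x) /\ g (f x) = x,
      forall y, V y -> U (g y) /\ f (g y) = y,
      {within U, continuous f} &
      {within V, continuous g}].

Definition local_homeomorphism (X Y : topologicalType) (f : X -> Y) : Prop :=
  forall x, exists (U : set X) (V : set Y) (g : Y -> X),
    [/\ open U, U x, open V & homeomorphism_on U V f g].

Definition topological_embedding (X Y : topologicalType) (f : X -> Y) : Prop :=
  injective f /\ @open X = @open (initial_topology f).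

(* Arrows are composed from left to right: [x y] is defined when [r x = d y]. *)
Definition composable (G1 G0 : Type) (d r : G1 -> G0) : set (G1 * G1) :=
  [set p | r p.1 = d p.2].

(* Groupoid with space of arrows [G1] and space of units [G0]. The set of
   composable pairs carries the subspace topology of [G1 * G1]. *)
Record topGroupoid (G1 G0 : topologicalType) := TopGroupoid {
  gdom : G1 -> G0;
  grng : G1 -> G0;
  gunit : G0 -> G1;
  ginv : G1 -> G1;
  gmul : forall x y : G1, grng x = gdom y -> G1;

  gdom_unit : forall a, gdom (gunit a) = a;
  grng_unit : forall a, grng (gunit a) = a;
  gdom_inv : forall x, gdom (ginv x) = grng x;
  grng_inv : forall x, grng (ginv x) = gdom x;
  gdom_mul : forall x y (xy : grng x = gdom y), gdom (gmul xy) = gdom x;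
  grng_mul : forall x y (xy : grng x = gdom y), grng (gmul xy) = grng y;
  gmulA : forall x y z (xy : grng x = gdom y) (yz : grng y = gdom z)
    (x_yz : grng x = gdom (gmul yz)) (xy_z : grng (gmul xy) = gdom z),
    gmul x_yz = gmul xy_z;
  gmul1g : forall x (ux : grng (gunit (gdom x)) = gdom x), gmul ux = x;
  gmulg1 : forall x (xu : grng x = gdom (gunit (grng x))), gmul xu = x;
  gmulgV : forall x (xV : grng x = gdom (ginv x)), gmul xV = gunit (gdom x);
  gmulVg : forall x (Vx : grng (ginv x) = gdom x), gmul Vx = gunit (grng x);

  gdom_continuous : continuous gdom;
  grng_continuous : continuous grng;
  gunit_continuous : continuous gunit;
  ginv_continuous : continuous ginv;
  gmul_continuous : continuous (fun p : set_type (composable gdom grng) =>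
    @gmul (val p).1 (val p).2 (set_valP p))
}.

Definition etale (G1 G0 : topologicalType) (G : topGroupoid G1 G0) : Prop :=
  local_homeomorphism (gdom G).

(* [j1] and [j0] identify [G] with a subgroupoid of [H], each of [G1] and [G0]
   having the topology induced from [H1] and [H0]. *)
Record subgroupoid_embedding (G1 G0 H1 H0 : topologicalType)
    (G : topGroupoid G1 G0) (H : topGroupoid H1 H0)
    (j1 : G1 -> H1) (j0 : G0 -> H0) : Prop := SubgroupoidEmbedding {
  sub_arrows : topological_embedding j1;
  sub_units : topological_embedding j0;
  sub_dom : forall x, gdom H (j1 x) = j0 (gdom G x);
  sub_rng : forall x, grng H (j1 x) = j0 (grng G x);
  sub_unit : forall a, gunit H (j0 a) = j1 (gunit G a);
  sub_inv : forall x, ginv H (j1 x) = j1 (ginv G x);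
  sub_mul : forall x y (xy : grng G x = gdom G y)
    (jxy : grng H (j1 x) = gdom H (j1 y)), gmul jxy = j1 (gmul xy)
}.

(* The space of ultrafilters on [X], i.e. the Stone-Cech compactification of
   the discrete space [X]. *)
Record beta (X : Type) : Type := Beta {
  beta_filter :> set_system X;
  beta_ultra : UltraFilter beta_filter
}.

HB.instance Definition _ (X : Type) := gen_eqMixin (beta X).
HB.instance Definition _ (X : Type) := gen_choiceMixin (beta X).

Definition beta_basic (X : Type) (U : set X) : set (beta X) :=
  [set F : beta X | beta_filter F U].

Lemma beta_basic_cover (X : Type) :
  \bigcup_(U in [set: set X]) beta_basic U = [set: beta X].
Proof.
apply/seteqP; split=> // F _; exists setT => //.
have FU := beta_ultra F; exact: filterT.
Qed.

Lemma beta_basic_join (X : Type) (U V : set X) (F : beta X) :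
  [set: set X] U -> [set: set X] V -> beta_basic U F -> beta_basic V F ->
  exists W, [/\ [set: set X] W, beta_basic W F &
                beta_basic W `<=` beta_basic U `&` beta_basic V].
Proof.
move=> _ _ FU FV; exists (U `&` V); split=> //.
  by have Fu := beta_ultra F; exact: filterI.
move=> G GUV; have Gu := beta_ultra G.
by split; apply: filterS GUV => x [].
Qed.

HB.instance Definition _ (X : Type) :=
  isBaseTopological.Build (beta X) (@beta_basic_cover X) (@beta_basic_join X).

Definition beta_principal (X : Type) (x : X) : beta X :=
  Beta (principal_filter_ultra x).

(* Main.v *)
Require Import Defs.
From mathcomp Require Import all_boot all_order all_algebra.
From mathcomp Require Import all_classical topology.

(** An arrow of the extended groupoid at an ultrafilter [a] of units should be
    the germ at [a] of a bisection [S], a set of arrows on which domain and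
    range are injective; two bisections have the same germ at [a] when they
    agree over a set belonging to [a]. As [d] is injective on [S], the
    ultrafilters on [G1] containing [S] correspond to the ultrafilters on [G0]
    containing [d @` S], and the germ of [S] at [a] is nothing but the
    ultrafilter [F] with [S] in [F] and [d] sending [F] to [a]. So the space of
    arrows is taken to be the set [germs] of the ultrafilters on [G1] that
    contain a bisection, with the topology induced from [beta G1]: no quotient
    is formed.

    Domain, range, unit and inverse are the extensions of those of [G] to
    ultrafilters by direct image. The product of [F] and [H] is generated by
    the sets [set_mul S T] with [S] in [F] and [T] in [H]. It is a proper
    filter when [r] sends [F] where [d] sends [H], and an ultrafilter because
    [H] contains a set on which [d] is injective ([beta_mul_ultra]).

    Equality of two ultrafilters follows from one inclusion ([beta_eq]), so
    each groupoid axiom is checked by exhibiting, for a set in one side, sets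
    whose product lies in it. The bisections are what makes [F F^-1] a unit:
    if [x] and [y] lie in a bisection and [x y^-1] is defined, then [x = y].
    Continuity holds because a set belongs to the value of an operation as soon
    as suitable sets belong to its arguments, and these suitable sets define
    basic open neighbourhoods. Finally [d] restricts to a homeomorphism from
    the germs containing a bisection [S] to the ultrafilters containing
    [d @` S], with inverse the direct image under a section of [d] over [S];
    and [G] embeds as the principal ultrafilters, which are isolated points. *)

Set Implicit Arguments.
Unset Strict Implicit.
Unset Printing Implicit Defensive.

Local Open Scope classical_set_scope.

(** * Ultrafilters, their direct images and the space they form *)

Section Ultrafilters.
Context {X : Type}.
Implicit Types (F H : beta X) (A B : set X).

Lemma betaI F A B : beta_filter F A -> beta_filter F B ->
  beta_filter F (A `&` B).
Proof. by have FU := beta_ultra F; exact: filterI. Qed.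

Lemma betaS F A B : A `<=` B -> beta_filter F A -> beta_filter F B.
Proof. by have FU := beta_ultra F; exact: filterS. Qed.

Lemma betaT F : beta_filter F setT.
Proof. by have FU := beta_ultra F; exact: filterT. Qed.

Lemma beta_ex F A : beta_filter F A -> exists x, A x.
Proof. by have FU := beta_ultra F; exact: filter_ex. Qed.

Lemma betaC F A : beta_filter F A \/ beta_filter F (~` A).
Proof. by have FU := beta_ultra F; exact: in_ultra_setVsetC. Qed.

(** Ultrafilters are maximal, hence pairwise incomparable. *)
Lemma beta_eq F H : beta_filter F `<=` beta_filter H -> F = H.
Proof.
move=> FH; have HU := beta_ultra H; have FU := beta_ultra F.
have HP : ProperFilter (beta_filter H) by exact: ultra_proper.
have := max_filter HP FH; case: F H {FH HU FU HP} => [f fu] [h hu] /= hf.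
by move: hu; rewrite hf => hu; congr Beta; exact: Prop_irrelevance.
Qed.

Lemma ultra_of_dichotomy (f : set_system X) : ProperFilter f ->
  (forall A, f A \/ f (~` A)) -> UltraFilter f.
Proof.
move=> fP fC; split=> // g gP fg; apply/seteqP; split=> // A gA.
have [//|/fg gCA] := fC A.
by have [x []] := filter_ex (filterI gA gCA).
Qed.

End Ultrafilters.

Lemma beta_push_ultra (X Y : Type) (f : X -> Y) (F : beta X) :
  UltraFilter [set A : set Y | beta_filter F (f @^-1` A)].
Proof.
apply: ultra_of_dichotomy; last by move=> A; exact: betaC.
have FU := beta_ultra F; exact: fmap_proper_filter.
Qed.

Definition beta_push (X Y : Type) (f : X -> Y) (F : beta X) : beta Y :=
  Beta (beta_push_ultra f F).

Lemma beta_push_comp (X Y Z : Type) (f : X -> Y) (g : Y -> Z) (F : beta X) :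
  beta_push g (beta_push f F) = beta_push (g \o f) F.
Proof. exact: beta_eq. Qed.

(** The direct image depends only on the germ of the function along [F]. *)
Lemma beta_push_eq (X Y : Type) (f g : X -> Y) (F : beta X) :
  beta_filter F [set x | f x = g x] -> beta_push f F = beta_push g F.
Proof.
move=> fg; apply: beta_eq => A /= /(betaI fg).
by apply: betaS => x /= [->].
Qed.

Lemma beta_push_id (X : Type) (f : X -> X) (F : beta X) :
  beta_filter F [set x | f x = x] -> beta_push f F = F.
Proof. by move=> /beta_push_eq ->; exact: beta_eq. Qed.

Lemma beta_push_principal (X Y : Type) (f : X -> Y) (x : X) :
  beta_push f (beta_principal x) = beta_principal (f x).
Proof. by apply/esym/beta_eq => A Afx _ ->; exact: Afx. Qed.

Lemma beta_principal_inj (X : Type) : injective (@beta_principal X).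
Proof.
move=> x y xy; have : beta_filter (beta_principal x) [set y] by rewrite xy.
by move=> /(_ x erefl).
Qed.

Lemma beta_principalE (X : Type) (x : X) (F : beta X) :
  beta_filter F [set x] -> F = beta_principal x.
Proof. by move=> Fx; apply/esym/beta_eq => A Ax; exact: betaS Fx. Qed.

Lemma beta_basic_open (X : Type) (U : set X) : open (beta_basic U).
Proof. by exists [set U] => //; rewrite bigcup_set1. Qed.

Lemma beta_near (X : Type) (U : set X) (F : beta X) : beta_filter F U ->
  \forall H \near F, beta_filter H U.
Proof.
by move=> FU; apply: open_nbhs_nbhs; split=> //; exact: beta_basic_open.
Qed.

Lemma beta_cvg (T : topologicalType) (X : Type) (f : T -> beta X) (t : T) :
  (forall U, beta_filter (f t) U -> \forall t' \near t, beta_filter (f t') U) ->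
  f x @[x --> t] --> f t.
Proof.
move=> near_f W; rewrite (@nbhsE (beta X)) => -[_ [[D _ <-]] [U DU fU] UW].
by apply: filterS (near_f U fU) => t' ft'U; apply: UW; exists U.
Qed.

Lemma isolated_embedding (X : discreteTopologicalType) (Y : topologicalType)
    (f : X -> Y) : injective f -> (forall x, open [set f x]) ->
  topological_embedding f.
Proof.
move=> f_inj f_open; split=> //; apply/seteqP.
split=> A _; last exact: discrete_open.
exists (\bigcup_(x in A) [set f x]); first by apply: bigcup_open => x _.
by apply/seteqP; split=> [x [y Ay /f_inj ->] | x Ax] //; exists x.
Qed.

Lemma beta_principal_embedding (X : discreteTopologicalType) :
  topological_embedding (@beta_principal X).
Proof.
apply: isolated_embedding => [|x]; first exact: beta_principal_inj.
have -> : [set beta_principal x] = beta_basic [set x].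
  by apply/seteqP; split=> [_ -> // | F]; exact: beta_principalE.
exact: beta_basic_open.
Qed.

(** * Products of sets of arrows and of ultrafilters of arrows *)

Section Germs.
Context {G1 G0 : topologicalType} (G : topGroupoid G1 G0).
Local Notation d := (gdom G).
Local Notation r := (grng G).
Local Notation u := (gunit G).
Local Notation inv := (ginv G).
Implicit Types (x y z : G1) (S T : set G1).

Definition bisection S : Prop := set_inj S d /\ set_inj S r.

Definition set_mul S T : set G1 :=
  [set z | exists x y (xy : r x = d y), [/\ S x, T y & gmul xy = z]].

Lemma set_mulS S S' T T' : S `<=` S' -> T `<=` T' ->
  set_mul S T `<=` set_mul S' T'.
Proof.
by move=> SS' TT' _ [x [y [xy [/SS' S'x /TT' T'y <-]]]]; exists x, y, xy.
Qed.

Lemma set_mul_mem S T x y (xy : r x = d y) : S x -> T y ->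
  set_mul S T (gmul xy).
Proof. by move=> Sx Ty; exists x, y, xy. Qed.

Lemma gmul_pi x y (e f : r x = d y) : gmul e = gmul f.
Proof. by congr gmul; exact: Prop_irrelevance. Qed.

Lemma set_mulA S T R : set_mul S (set_mul T R) `<=` set_mul (set_mul S T) R.
Proof.
move=> _ [x [w [xw [Sx [y [z [yz [Ty Rz def_w]]]] <-]]]]; subst w.
have xy : r x = d y by rewrite xw gdom_mul.
have xy_z : r (gmul xy) = d z by rewrite grng_mul.
by rewrite (gmulA xw xy_z); do 2!apply: set_mul_mem => //.
Qed.

Lemma bisection_mul S T : bisection S -> bisection T -> bisection (set_mul S T).
Proof.
move=> [dS rS] [dT rT].
have eq_gmul x y x' y' (e : r x = d y) (e' : r x' = d y') :
    x = x' -> y = y' -> gmul e = gmul e'.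
  by move=> xx' yy'; subst x' y'; exact: gmul_pi.
split=> _ _ /set_mem[x [y [e [Sx Ty <-]]]] /set_mem[x' [y' [e' [Sx' Ty' <-]]]].
  rewrite !gdom_mul => dxx'; have xx' := dS _ _ (mem_set Sx) (mem_set Sx') dxx'.
  by apply: eq_gmul => //; apply: dT; rewrite ?inE// -e -e' xx'.
rewrite !grng_mul => ryy'; have yy' := rT _ _ (mem_set Ty) (mem_set Ty') ryy'.
by apply: eq_gmul => //; apply: rS; rewrite ?inE// e e' yy'.
Qed.

Definition beta_mul (F H : beta G1) : set_system G1 :=
  [set A | exists S T,
    [/\ beta_filter F S, beta_filter H T & set_mul S T `<=` A]].

(** Properness uses that [F] and [H] are composable: the sets [r @` S] and
    [d @` R] belong to the same ultrafilter, so they meet. Maximality uses that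
    an arrow [x] is composable with at most one element of [T]: for a set [A],
    either the [x] whose product with that element exists and lies in [A] form
    a set of [F], or their complement does. *)
Lemma beta_mul_ultra (F H : beta G1) T : beta_push r F = beta_push d H ->
  beta_filter H T -> set_inj T d -> UltraFilter (beta_mul F H).
Proof.
move=> FH HT dT; apply: ultra_of_dichotomy.
  apply: Build_ProperFilter_ex.
    move=> A [S [R [FS HR SRA]]].
    have : beta_filter (beta_push r F) (r @` S `&` d @` R).
      apply: betaI; first by apply: betaS FS => x Sx; exists x.
      by rewrite FH; apply: betaS HR => y Ry; exists y.
    case/beta_ex=> a [[x Sx xa] [y Ry ya]].
    have xy : r x = d y by rewrite xa ya.
    by exists (gmul xy); apply: SRA; exact: set_mul_mem.
  split.
  - by exists setT, setT; split=> //; exact: betaT.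
  - move=> A B [S [R [FS HR SRA]]] [S' [R' [FS' HR' SRB]]].
    exists (S `&` S'), (R `&` R'); split; [exact: betaI|exact: betaI|].
    move=> z SRz; split; [apply: SRA|apply: SRB].
      by apply: set_mulS SRz => ? [].
    by apply: set_mulS SRz => ? [].
  - by move=> A B AB [S [R [FS HR SRA]]]; exists S, R; split=> // z /SRA /AB.
move=> A.
pose S := [set x | exists y (xy : r x = d y), T y /\ A (gmul xy)].
have [FS|FS] := betaC F S; [left|right].
  exists S, T; split=> // _ [x [y [xy [[y' [xy' [Ty' Axy']]] Ty <-]]]].
  have yy' : y = y' by apply: dT; rewrite ?inE// -xy.
  by subst y'; rewrite (gmul_pi xy xy').
exists (~` S), T; split=> // _ [x [y [xy [nSx Ty <-]]]] Axy.
by apply: nSx; exists y, xy.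
Qed.

(** * The groupoid of germs of bisections *)

Definition germs : set (beta G1) :=
  [set F | exists2 S, beta_filter F S & bisection S].

Local Notation germ := (set_type germs).
Implicit Types (F H K : germ).

Lemma germ_eq F H : beta_filter (val F) `<=` beta_filter (val H) -> F = H.
Proof. by move=> FH; apply: val_inj; exact: beta_eq. Qed.

Lemma germP F : exists2 S, beta_filter (val F) S & bisection S.
Proof. exact: (set_valP F). Qed.

Lemma germ_near U F : beta_filter (val F) U ->
  \forall H \near F, beta_filter (val H) U.
Proof. by move=> FU; exact: (@initial_continuous _ _ val) (beta_near FU). Qed.

(** [germs] has the induced topology, so a map into it is continuous as soon as
    it is so as a map into [beta G1]. *)
Lemma germ_cvg (T : topologicalType) (f : T -> germ) (t : T) :
  (forall U, beta_filter (val (f t)) U ->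
     \forall t' \near t, beta_filter (val (f t')) U) ->
  f x @[x --> t] --> f t.
Proof.
move=> near_f W; rewrite (@nbhsE germ) => -[_ [[V oV <-] Vft] VW].
have : (val \o f) x @[x --> t] --> val (f t) by exact: beta_cvg.
move=> /(_ V (open_nbhs_nbhs (conj oV Vft))).
apply: (@filterS _ (nbhs t) _) => x; exact: VW.
Qed.

Definition germ_dom F : beta G0 := beta_push d (val F).
Definition germ_rng F : beta G0 := beta_push r (val F).

Lemma beta_push_range (a : beta G0) : beta_filter (beta_push u a) (range u).
Proof. by apply: betaS (betaT a) => x _; exists x. Qed.

(** The set of all units is a bisection. *)
Lemma germs_unit (a : beta G0) : germs (beta_push u a).
Proof.
exists (range u); first exact: beta_push_range.
split=> _ _ /set_mem[x _ <-] /set_mem[y _ <-].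
  by rewrite !gdom_unit => ->.
by rewrite !grng_unit => ->.
Qed.

Lemma germs_inv F : germs (beta_push inv (val F)).
Proof.
have [S FS [dS rS]] := germP F.
exists (inv @` S); first by apply: betaS FS => x Sx; exists x.
split=> _ _ /set_mem[x Sx <-] /set_mem[y Sy <-].
  by rewrite !gdom_inv => /rS ->; rewrite ?inE.
by rewrite !grng_inv => /dS ->; rewrite ?inE.
Qed.

Lemma germ_mul_ultra F H : germ_rng F = germ_dom H ->
  UltraFilter (beta_mul (val F) (val H)).
Proof. by have [T HT [dT _]] := germP H => FH; exact: beta_mul_ultra HT dT. Qed.

Lemma germs_mul F H (FH : germ_rng F = germ_dom H) :
  germs (Beta (germ_mul_ultra FH)).
Proof.
have [S FS bS] := germP F; have [T HT bT] := germP H.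
by exists (set_mul S T); [exists S, T; split|exact: bisection_mul].
Qed.

Definition germ_unit a : germ := SigSub (mem_set (germs_unit a)).
Definition germ_inv F : germ := SigSub (mem_set (germs_inv F)).
Definition germ_mul F H (FH : germ_rng F = germ_dom H) : germ :=
  SigSub (mem_set (germs_mul FH)).

Lemma germ_dom_unit a : germ_dom (germ_unit a) = a.
Proof.
rewrite /germ_dom beta_push_comp; apply: beta_push_id.
by apply: betaS (betaT a) => x _; exact: gdom_unit.
Qed.

Lemma germ_rng_unit a : germ_rng (germ_unit a) = a.
Proof.
rewrite /germ_rng beta_push_comp; apply: beta_push_id.
by apply: betaS (betaT a) => x _; exact: grng_unit.
Qed.

Lemma germ_dom_inv F : germ_dom (germ_inv F) = germ_rng F.
Proof.
rewrite /germ_dom beta_push_comp; apply: beta_push_eq.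
by apply: betaS (betaT (val F)) => x _; exact: gdom_inv.
Qed.

Lemma germ_rng_inv F : germ_rng (germ_inv F) = germ_dom F.
Proof.
rewrite /germ_rng beta_push_comp; apply: beta_push_eq.
by apply: betaS (betaT (val F)) => x _; exact: grng_inv.
Qed.

Lemma germ_dom_mul F H (FH : germ_rng F = germ_dom H) :
  germ_dom (germ_mul FH) = germ_dom F.
Proof.
apply/esym/beta_eq => A FA; exists (d @^-1` A), setT; split=> //.
  exact: betaT.
by move=> _ [x [y [xy [Ax _ <-]]]]; rewrite /= gdom_mul.
Qed.

Lemma germ_rng_mul F H (FH : germ_rng F = germ_dom H) :
  germ_rng (germ_mul FH) = germ_rng H.
Proof.
apply/esym/beta_eq => A HA; exists setT, (r @^-1` A); split=> //.
  exact: betaT.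
by move=> _ [x [y [xy [_ Ay <-]]]]; rewrite /= grng_mul.
Qed.

Lemma germ_mulA F H K (FH : germ_rng F = germ_dom H)
    (HK : germ_rng H = germ_dom K)
    (F_HK : germ_rng F = germ_dom (germ_mul HK))
    (FH_K : germ_rng (germ_mul FH) = germ_dom K) :
  germ_mul F_HK = germ_mul FH_K.
Proof.
apply/esym/germ_eq => A [W [R [[S [T [FS HT STW]]] KR WRA]]].
exists S, (set_mul T R); split=> //; first by exists T, R; split.
by move=> z /set_mulA /(set_mulS STW (@subset_refl _ R)) /WRA.
Qed.

(** In the two unit laws, a set [A] of [F] contains its own product with the
    set of all units. *)
Lemma germ_mul1g F (uF : germ_rng (germ_unit (germ_dom F)) = germ_dom F) :
  germ_mul uF = F.
Proof.
apply/esym/germ_eq => A FA; exists (range u), A; split=> //.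
  exact: beta_push_range.
move=> _ [w [x [e [[a _ def_w] Ax <-]]]]; subst w.
have ax : a = d x by rewrite -e grng_unit.
by subst a; rewrite gmul1g.
Qed.

Lemma germ_mulg1 F (Fu : germ_rng F = germ_dom (germ_unit (germ_rng F))) :
  germ_mul Fu = F.
Proof.
apply/esym/germ_eq => A FA; exists A, (range u); split=> //.
  exact: beta_push_range.
move=> _ [x [w [e [Ax [a _ def_w] <-]]]]; subst w.
have ax : a = r x by rewrite e gdom_unit.
by subst a; rewrite gmulg1.
Qed.

(** Let [S] be a bisection in [F]. If [x] and [y] are in [S] and [x y^-1] is
    defined, then [x] and [y] have the same range, hence are equal: the product
    of a subset of [S] with its inverse consists of units. *)
Lemma germ_mulgV F (FV : germ_rng F = germ_dom (germ_inv F)) :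
  germ_mul FV = germ_unit (germ_dom F).
Proof.
have [S FS [_ rS]] := germP F.
apply/esym/germ_eq => A FA.
have FSA : beta_filter (val F) (S `&` [set x | A (u (d x))]) by exact: betaI.
exists (S `&` [set x | A (u (d x))]), (inv @` (S `&` [set x | A (u (d x))])).
split=> //; first by apply: betaS FSA => x Sx; exists x.
move=> _ [x [w [e [[Sx Ax] [y [Sy _] def_w] <-]]]]; subst w.
have xy : x = y by apply: rS; rewrite ?inE// e gdom_inv.
by subst y; rewrite gmulgV.
Qed.

Lemma germ_mulVg F (VF : germ_rng (germ_inv F) = germ_dom F) :
  germ_mul VF = germ_unit (germ_rng F).
Proof.
have [S FS [dS _]] := germP F.
apply/esym/germ_eq => A FA.
have FSA : beta_filter (val F) (S `&` [set x | A (u (r x))]) by exact: betaI.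
exists (inv @` (S `&` [set x | A (u (r x))])), (S `&` [set x | A (u (r x))]).
split=> //; first by apply: betaS FSA => x Sx; exists x.
move=> _ [w [y [e [[x [Sx _] def_w] [Sy Ay] <-]]]]; subst w.
have xy : x = y by apply: dS; rewrite ?inE// -e grng_inv.
by subst y; rewrite gmulVg.
Qed.

Lemma germ_dom_continuous : continuous germ_dom.
Proof. by move=> F; apply: beta_cvg => U; exact: (@germ_near (d @^-1` U)). Qed.

Lemma germ_rng_continuous : continuous germ_rng.
Proof. by move=> F; apply: beta_cvg => U; exact: (@germ_near (r @^-1` U)). Qed.

Lemma germ_unit_continuous : continuous germ_unit.
Proof.
by move=> a; apply: germ_cvg => U; exact: (@beta_near _ (u @^-1` U)).
Qed.

Lemma germ_inv_continuous : continuous germ_inv.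
Proof.
by move=> F; apply: germ_cvg => U; exact: (@germ_near (inv @^-1` U)).
Qed.

(** If [set_mul S T] is contained in [U], the product of a germ containing [S]
    and a germ containing [T] contains [U]. *)
Lemma germ_mul_continuous :
  continuous (fun p : set_type (composable germ_dom germ_rng) =>
    @germ_mul (val p).1 (val p).2 (set_valP p)).
Proof.
move=> p; apply: germ_cvg => U [S [T [pS pT STU]]].
have cvg_val : val x @[x --> p] --> val p.
  exact: (@initial_continuous _ _ (val : set_type _ -> _)).
have : \forall q \near val p,
    beta_filter (val q.1) S /\ beta_filter (val q.2) T.
  by exists ([set H | beta_filter (val H) S], [set H | beta_filter (val H) T]);
    first by split; exact: germ_near.
by move=> /cvg_val; apply: (@filterS _ (nbhs p) _) => q [qS qT]; exists S, T.
Qed.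

Definition germ_groupoid : topGroupoid germ (beta G0) :=
  TopGroupoid germ_dom_unit germ_rng_unit germ_dom_inv germ_rng_inv
    germ_dom_mul germ_rng_mul germ_mulA germ_mul1g germ_mulg1 germ_mulgV
    germ_mulVg germ_dom_continuous germ_rng_continuous germ_unit_continuous
    germ_inv_continuous germ_mul_continuous.

Lemma bisection_section S : bisection S ->
  exists s : G0 -> G1, forall x, S x -> s (d x) = x.
Proof.
move=> [dS _].
exists (fun a => if pselect (exists2 x, S x & d x = a) is left e
  then projT1 (cid2 e) else u a) => x Sx.
case: pselect => [e|[]]; last by exists x.
by case: (cid2 e) => y /= Sy yx; apply: dS; rewrite ?inE.
Qed.

(** Let [S] be a bisection in the germ [F] and [s] a section of [d] over [S].
    Direct image under [s] inverts [d] between the germs containing [S] and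
    the ultrafilters containing [d @` S], since [s \o d] and [d \o s] are the
    identity on sets of these ultrafilters. *)
Lemma germ_groupoid_etale : etale germ_groupoid.
Proof.
move=> F; have [S FS bS] := germP F; have [s sK] := bisection_section bS.
have germ_s (K : beta G0) : beta_filter K (d @` S) -> germs (beta_push s K).
  by move=> KS; exists S => //; apply: betaS KS => _ [x Sx <-] /=; rewrite sK.
(* Outside [beta_basic (d @` S)] the image under [s] may fail to be a germ;
   the value there is then [F]. *)
pose g (K : beta G0) : germ := insubd F (beta_push s K).
have val_g (K : beta G0) : beta_filter K (d @` S) -> val (g K) = beta_push s K.
  by move=> KS; rewrite insubdK//; apply: mem_set; exact: germ_s.
exists [set H | beta_filter (val H) S], (beta_basic (d @` S)), g; split=> //.
- rewrite openE => H HS; exact: germ_near.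
- exact: beta_basic_open.
split.
- move=> H HS; have HdS : beta_filter (germ_dom H) (d @` S).
    by apply: betaS HS => x Sx; exists x.
  split=> //; apply: val_inj; rewrite val_g// beta_push_comp.
  by apply: beta_push_id; apply: betaS HS => x; exact: sK.
- move=> K KS; split.
    by rewrite /= val_g//; apply: betaS KS => _ [x Sx <-] /=; rewrite sK.
  rewrite /= /germ_dom val_g// beta_push_comp; apply: beta_push_id.
  by apply: betaS KS => _ [x Sx <-] /=; rewrite sK.
- by apply: continuous_subspaceT; exact: germ_dom_continuous.
rewrite continuous_open_subspace; last exact: beta_basic_open.
move=> K /set_mem KS; apply: germ_cvg => U; rewrite val_g// => KU.
have := @beta_near _ (s @^-1` U) K KU.
by apply: filterS2 (beta_near KS) => L LS LU; rewrite val_g.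
Qed.

Lemma germs_principal x : germs (beta_principal x).
Proof. by exists [set x] => //; split=> _ _ /set_mem-> /set_mem->. Qed.

Definition germ_principal x : germ := SigSub (mem_set (germs_principal x)).

End Germs.

Theorem theorem4p4 (G1 G0 : discreteTopologicalType) (G : topGroupoid G1 G0) :
  exists (B1 : topologicalType) (B : topGroupoid B1 (beta G0)),
    etale B /\
    exists j1 : G1 -> B1, subgroupoid_embedding G B j1 (@beta_principal G0).
Proof.
exists (set_type (germs G)), (germ_groupoid G); split.
  exact: germ_groupoid_etale.
exists (germ_principal G); split.
- apply: isolated_embedding => [x y xy | x].
    exact: beta_principal_inj (congr1 val xy).
  have -> : [set germ_principal G x] = [set H | beta_filter (val H) [set x]].
    apply/seteqP; split=> [_ -> // | F Fx]; apply: val_inj.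
    exact: beta_principalE.
  by rewrite openE => H HS; exact: germ_near.
- exact: beta_principal_embedding.
- by move=> x; exact: beta_push_principal.
- by move=> x; exact: beta_push_principal.
- by move=> a; apply: val_inj; exact: beta_push_principal.
- by move=> x; apply: val_inj; exact: beta_push_principal.
move=> x y xy jxy; apply/esym/germ_eq => A Axy.
exists [set x], [set y]; split=> // _ [x' [y' [e [xx' yy' <-]]]].
rewrite /= in xx' yy'; subst x' y'; rewrite (gmul_pi e xy); exact: Axy.
Qed.
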